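(* $\displaystyle\liminf_{k\to\infty}\frac{\gamma(k)}{k}\geq\frac12$ and $\displaystyle\limsup_{k\to\infty}\frac{\gamma(k)}{k}\geq 1$.
   Context: The Thue–Morse word is $\mathbf t=\mathbf t_1\mathbf t_2\cdots$ where $\mathbf t_i\in\{0,1\}$ has the parity of the number of $1$'s in the binary expansion of $i-1$. For positive integers $\alpha\le\beta$, $\langle\alpha,\beta\rangle=\mathbf t_\alpha\cdots\mathbf t_\beta$. A $k$-anti-power is a word $w_1\cdots w_k$ with $w_1,\dots,w_k$ pairwise distinct words of equal length. $\mathcal F(k)$ is the set of odd positive integers $m$ such that $\langle 1,km\rangle$ is a $k$-anti-power (this set is nonempty for every $k$). $\gamma(k)=\min\mathcal F(k)$. *)

(* Defs.v *)
From HB Require Import structures.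
From mathcomp Require Import all_boot all_order all_algebra.
From Stdlib Require Import ClassicalEpsilon.
Set Implicit Arguments. Unset Strict Implicit. Unset Printing Implicit Defensive.
Import Order.TTheory GRing.Theory Num.Theory.

(* number of 1's in the binary expansion of n (fuel n suffices) *)
Fixpoint popcount_aux (fuel n : nat) : nat :=
  match fuel with
  | 0 => 0
  | f.+1 => (odd n : nat) + popcount_aux f n./2
  end.
Definition popcount (n : nat) : nat := popcount_aux n n.

(* Thue--Morse word, 1-indexed: t_i = parity of popcount (i-1) *)
Definition tm (i : nat) : bool := odd (popcount i.-1).

Definition tm_factor (alpha beta : nat) : seq bool :=
  [seq tm i | i <- iota alpha (beta.+1 - alpha)].

Definition anti_power (k : nat) (w : seq bool) : bool :=
  (k %| size w) &&
  uniq [seq take (size w %/ k) (drop (j * (size w %/ k)) w) | j <- iota 0 k].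

Definition inF (k m : nat) : bool := odd m && anti_power k (tm_factor 1 (k * m)).

(* gamma(k) = min F(k)  (set to 0 if F(k) were empty; it is known to be nonempty) *)
Definition gamma (k : nat) : nat :=
  match excluded_middle_informative (exists m, inF k m) with
  | left H => ex_minn H
  | right _ => 0
  end.

Local Open Scope ring_scope.
Definition gamma_ratio (k : nat) : rat := (gamma k)%:R / k%:R.

(* Main.v *)
Require Import Defs.
From HB Require Import structures.
From mathcomp Require Import all_boot all_order all_algebra.
From mathcomp Require Import zify ring lra.
From Stdlib Require Import ClassicalEpsilon.
Set Implicit Arguments. Unset Strict Implicit. Unset Printing Implicit Defensive.
Import Order.TTheory GRing.Theory Num.Theory.

(* If m is odd and 2^e is at least about m, then some r = o(m) makes the blocks of
   length m numbered r and r + 2^e equal; hence m in F(k) forces k <= r + 2^e.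
   Taking e minimal gives k <= (2 + o(1)) m, and taking k = 2^n (2^t + 1), e = n + t
   forces m >= 2^e - 3.
   With t the word indexed from 0, the two blocks are equal as soon as
   t(m + Q) = t(Q) for each quotient Q = (r m + x) / 2^e, 0 <= x < m; there are at
   most two of them, q and q + 1. Write m = 2^a u + w or m = 2^a u - w with u odd,
   a >= 3 and w in {1, 3}. If 2^a is small compared with m, some q < 3 * 2^a is such
   that q and q + 1 both qualify; if u is bounded, r can be chosen so that a single
   q occurs, running through an arithmetic progression of odd difference u on which
   t(q) + t(q +- w) takes both values. *)

(** * Digit recursion for the Thue-Morse word *)

Local Open Scope nat_scope.

(* The word indexed from 0: [tm0 n] is t_{n+1}. *)
Definition tm0 (n : nat) : bool := odd (popcount n).

Lemma popcount_aux_fuel f g n :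
  n <= f -> n <= g -> popcount_aux f n = popcount_aux g n.
Proof.
elim: f g n => [|f IH] [|g] [|n] //= hf hg; last by rewrite (IH g) //; lia.
- by elim: g {hg} => //= g <-.
- by elim: f {IH hf} => //= f ->.
- by rewrite (IH g).
Qed.

Lemma tm0_step n : tm0 n = odd n (+) tm0 n./2.
Proof.
case: n => [|n] //; rewrite /tm0 /popcount /= oddD oddb.
by rewrite (@popcount_aux_fuel n (uphalf n)) //; lia.
Qed.

Lemma tm0_double n : tm0 n.*2 = tm0 n.
Proof. by rewrite tm0_step odd_double doubleK. Qed.

Lemma tm0_doubleS n : tm0 n.*2.+1 = ~~ tm0 n.
Proof. by rewrite tm0_step /= odd_double uphalf_double. Qed.

(** The binary digits of [R] lie below those of [2 ^ e * Q], so the digit sums add. *)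
Lemma tm0_split e Q R : R < 2 ^ e -> tm0 (2 ^ e * Q + R) = tm0 Q (+) tm0 R.
Proof.
elim: e R => [|e IH] R; first by case: R => // _; rewrite mul1n addn0 addbF.
rewrite expnS => hR; rewrite tm0_step [in RHS](tm0_step R).
have -> : (2 * 2 ^ e * Q + R)./2 = 2 ^ e * Q + R./2 by lia.
have hR2 : R./2 < 2 ^ e by lia.
have -> : odd (2 * 2 ^ e * Q + R) = odd R by lia.
by rewrite (IH _ hR2) addbCA.
Qed.

(** * Equal blocks at distance a power of two *)

Definition same_block (m i j : nat) : Prop :=
  forall n, n < m -> tm0 (i * m + n) = tm0 (j * m + n).

(* The two blocks start 2^e * m apart, so only the quotients Q of the positions by
   2^e matter: the shift replaces Q by m + Q and keeps the remainder. *)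
Lemma same_block_shift m e r :
  (forall n, n < m -> tm0 (m + (r * m + n) %/ 2 ^ e) = tm0 ((r * m + n) %/ 2 ^ e)) ->
  same_block m r (r + 2 ^ e).
Proof.
move=> h n /h; have := divn_eq (r * m + n) (2 ^ e).
have : (r * m + n) %% 2 ^ e < 2 ^ e by rewrite ltn_mod expn_gt0.
move: (_ %/ _) (_ %% _) => Q R hR E hQ.
have -> : (r + 2 ^ e) * m + n = 2 ^ e * (m + Q) + R.
  by rewrite mulnDl addnAC E; ring.
by rewrite E mulnC !tm0_split // hQ.
Qed.

Lemma same_block_one m e r q :
  tm0 (m + q) = tm0 q -> 2 ^ e * q <= r * m -> r * m + m <= 2 ^ e * q.+1 ->
  same_block m r (r + 2 ^ e).
Proof.
move=> hq h1 h2; apply: same_block_shift => n hn.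
suff -> : (r * m + n) %/ 2 ^ e = q by [].
by apply/eqP; rewrite eqn_leq leq_divRL ?expn_gt0 // -ltnS ltn_divLR ?expn_gt0 //; nia.
Qed.

Lemma same_block_two m e r q :
  tm0 (m + q) = tm0 q -> tm0 (m + q.+1) = tm0 q.+1 ->
  2 ^ e * q <= r * m -> r * m + m <= 2 ^ e * q.+2 ->
  same_block m r (r + 2 ^ e).
Proof.
move=> hq hq1 h1 h2; apply: same_block_shift => n hn.
have h3 : q <= (r * m + n) %/ 2 ^ e by rewrite leq_divRL ?expn_gt0 //; nia.
have h4 : (r * m + n) %/ 2 ^ e < q.+2 by rewrite ltn_divLR ?expn_gt0 //; nia.
have [->|->] // : (r * m + n) %/ 2 ^ e = q \/ (r * m + n) %/ 2 ^ e = q.+1 by lia.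
Qed.

(** * Odd shifts and odd arithmetic progressions *)

Lemma odd_tm0_shift u c : odd u ->
  exists2 v, v <= 2 & tm0 (u + v) (+) tm0 v = c.
Proof.
move=> hu; pose n := u./2.
(* t(u + 1) and t(u + 2) differ, since both arguments halve to [n.+1], while t(1) = t(2). *)
have e1 : u + 1 = n.+1.*2 by lia.
have e2 : u + 2 = n.+1.*2.+1 by lia.
case E : (tm0 n.+1 (+) c).
  by exists 1; rewrite // e1 tm0_double; move: E; case: (tm0 _); case: c.
by exists 2; rewrite // e2 tm0_doubleS; move: E; case: (tm0 _); case: c.
Qed.

(** An odd number is at distance 1 or 3 from a multiple of 8, nonzero here as [5 <= m]; [2 ^ a] is
    the full power of 2 in that multiple. *)
Lemma near_multiple_pow2 m : odd m -> 5 <= m ->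
  exists a u w, [/\ odd u, 3 <= a, w = 1 \/ w = 3 &
    m = 2 ^ a * u + w \/ m + w = 2 ^ a * u].
Proof.
move=> om hm.
have [x [w [x0 hw hx]]] : exists x w, [/\ 0 < x, w = 1 \/ w = 3 &
    m = 8 * x + w \/ m + w = 8 * x].
  have : [\/ m %% 8 = 1, m %% 8 = 3, m %% 8 = 5 | m %% 8 = 7].
    have : m %% 8 < 8 by rewrite ltn_mod.
    have : odd (m %% 8) by lia.
    by case: (m %% 8) => [|[|[|[|[|[|[|[|?]]]]]]]] //; constructor.
  case=> hr; [exists (m %/ 8), 1|exists (m %/ 8), 3|
    exists (m %/ 8).+1, 3|exists (m %/ 8).+1, 1]; split; lia.
have [y hy ey] := pfactor_coprime (isT : prime 2) x0.
exists (3 + logn 2 x), y, w; split => //; first by rewrite -coprime2n.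
by rewrite expnD; lia.
Qed.

Lemma tm0_odd_progression u q0 w c : odd u -> w = 1 \/ w = 3 ->
  exists2 j, j < 8 & tm0 (u * j + q0) (+) tm0 (u * j + q0 + w) = c.
Proof.
move=> ou hw.
(* Adding [w] to [rho] causes no carry out of the low three bits, so the higher bits cancel; [u] is
   invertible modulo 8, so the residue [rho] is attained. *)
have [rho hrho [hw8 ht]] : exists2 rho, rho < 8 & rho + w < 8 /\ tm0 rho (+) tm0 (rho + w) = c.
  case: hw => ->; case: c; [exists 0|exists 1|exists 2|exists 0]; by [].
have [j hj ej] : exists2 j, j < 8 & (u * j + q0) %% 8 = rho.
  have cu : coprime u 8 by rewrite (@coprimeXr 3 u 2) // coprimen2.
  have [i i' ei _] := egcdnP 8 (odd_gt0 ou); rewrite (eqP cu) in ei.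
  exists ((i * (rho + 7 * q0)) %% 8); first by rewrite ltn_mod.
  rewrite -modnDml modnMmr mulnA (mulnC u) ei modnDml.
  have -> : (i' * 8 + 1) * (rho + 7 * q0) + q0 = rho + (i' * (rho + 7 * q0) + q0) * 8 by ring.
  by rewrite addnC modnMDl modn_small.
exists j => //; set q := u * j + q0 in ej *.
have -> : q = 2 ^ 3 * (q %/ 8) + rho by rewrite -ej mulnC -divn_eq.
rewrite -addnA (@tm0_split 3 _ _ hrho) (@tm0_split 3 _ _ hw8) -ht.
by move: (tm0 _) (tm0 _) (tm0 _) => [] [] [].
Qed.

(** * Equal blocks with small r *)

(* Near q = 2^a v + p with p <= 4 no carry reaches the bit 2^a, so whether q and
   q + 1 are both good is decided by v alone; since u is odd, v = 1 or v = 2 works. *)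
Lemma small_shift_coarse m a u w e : odd u -> 3 <= a -> w = 1 \/ w = 3 ->
  m = 2 ^ a * u + w \/ m + w = 2 ^ a * u ->
  m <= 2 ^ e -> 2 ^ e <= 4 * m ->
  exists2 r, r <= 13 * 2 ^ a & same_block m r (r + 2 ^ e).
Proof.
move=> ou ha hw hm he1 he2.
have a8 : 8 <= 2 ^ a by rewrite (@leq_exp2l 2 3).
(* Each pair is picked so that [q] and [q + 1] impose the same condition on [v]. *)
have [p [p' [hp hp' hpp htt]]] : exists p p', [/\ p <= 4, p' <= 4,
    m + p = 2 ^ a * u + p' & tm0 p (+) tm0 p' = tm0 p.+1 (+) tm0 p'.+1].
  case: hw hm => -> [hm|hm]; [exists 3, 4|exists 4, 3|exists 0, 3|exists 3, 0];
    split=> //; lia.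
have [v hv htv] := odd_tm0_shift (tm0 p (+) tm0 p') ou.
have good x x' : x < 8 -> x' < 8 -> m + x = 2 ^ a * u + x' ->
    tm0 x (+) tm0 x' = tm0 p (+) tm0 p' -> tm0 (m + (2 ^ a * v + x)) = tm0 (2 ^ a * v + x).
  move=> hx hx' E ht.
  have -> : m + (2 ^ a * v + x) = 2 ^ a * (u + v) + x' by rewrite addnCA E; ring.
  rewrite (tm0_split _ (leq_trans hx a8)) (tm0_split _ (leq_trans hx' a8)).
  by move: ht htv; move: (tm0 x) (tm0 x') (tm0 p) (tm0 p') (tm0 v) (tm0 (u + v)) => [] [] [] [] [] [].
set q := 2 ^ a * v + p.
have hq : q <= 3 * 2 ^ a by rewrite /q; nia.
have m0 : 0 < m by have := expn_gt0 2 e; lia.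
(* The first block starting after [2 ^ e * q]; it ends by [2 ^ e * q + 2 * m], and [m <= 2 ^ e]. *)
exists ((2 ^ e * q) %/ m).+1.
  have : (2 ^ e * q) %/ m <= 4 * q.
    by rewrite -ltnS ltn_divLR //; nia.
  by lia.
have := divn_eq (2 ^ e * q) m; have : (2 ^ e * q) %% m < m by rewrite ltn_mod.
move: (_ %/ _) (_ %% _) => d s hs E.
apply: (@same_block_two _ _ _ q).
- by apply: (good p p'); lia.
- by rewrite /q -addnS; apply: (good p.+1 p'.+1); rewrite ?htt; lia.
- by rewrite mulSn E; lia.
- by rewrite mulSn !mulnS E; lia.
Qed.

(* With C = e - a, r is chosen as a multiple of 2^C, so that r m / 2^e exceeds a
   multiple of u only slightly and a single quotient occurs. *)
Lemma small_shift_fine_pos m a u w e : odd u -> w = 1 \/ w = 3 ->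
  m = 2 ^ a * u + w -> m + 4 <= 2 ^ e -> 36 * 2 ^ e <= 2 ^ a * 2 ^ a ->
  exists2 r, r * 2 ^ a <= 12 * 2 ^ e & same_block m r (r + 2 ^ e).
Proof.
move=> ou hw hm he ha.
have u0 := odd_gt0 ou.
have ae : a < e by rewrite -(@ltn_exp2l 2) //; nia.
move: he ha; rewrite -(subnKC (ltnW ae)) expnD.
have : 0 < e - a by lia.
move: (e - a) => C C0.
have A0 : 0 < 2 ^ a by rewrite expn_gt0.
have B0 : 0 < 2 ^ C by rewrite expn_gt0.
move=> he ha.
have uB : u < 2 ^ C by nia.
have AB : 36 * 2 ^ C <= 2 ^ a by nia.
(* As [m + u * j = 2 ^ a * u + (u * j + w)] with [u * j + w < 2 ^ a], the quotient [u * j] qualifies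
   when t changes by t(u) from [u * j] to [u * j + w]. *)
have [j hj htj] := tm0_odd_progression 0 (tm0 u) ou hw; rewrite addn0 in htj.
exists (2 ^ C * j); first by nia.
rewrite -expnD; apply: (@same_block_one _ _ _ (u * j)); rewrite ?expnD.
- rewrite hm -addnA (addnC w) tm0_split; last by nia.
  by rewrite -htj; move: (tm0 _) (tm0 _) => [] [].
- by rewrite hm; nia.
- rewrite hm mulnS.
  have -> : 2 ^ C * j * (2 ^ a * u + w) = 2 ^ a * 2 ^ C * (u * j) + 2 ^ C * j * w by ring.
  have : 2 ^ a * u.+1 <= 2 ^ a * 2 ^ C by rewrite leq_mul2l uB orbT.
  have : 2 ^ C * j * w + w <= 2 ^ a by nia.
  by rewrite mulnS; lia.
Qed.

(* Here r m / 2^e must lie slightly below a point with fractional part 2^-C, hence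
   the choice of i with i u = 1 modulo 2^C. *)
Lemma small_shift_fine_neg m a u w e : odd u -> w = 1 \/ w = 3 ->
  m + w = 2 ^ a * u -> m + 4 <= 2 ^ e -> 36 * 2 ^ e <= 2 ^ a * 2 ^ a ->
  exists2 r, r * 2 ^ a <= 12 * 2 ^ e & same_block m r (r + 2 ^ e).
Proof.
move=> ou hw hm he ha.
have u0 := odd_gt0 ou.
have ae : a < e by rewrite -(@ltn_exp2l 2) //; nia.
move: he ha; rewrite -(subnKC (ltnW ae)) expnD.
have : 0 < e - a by lia.
move: (e - a) => C C0.
have A0 : 0 < 2 ^ a by rewrite expn_gt0.
have B0 : 0 < 2 ^ C by rewrite expn_gt0.
move=> he ha.
have uB : u < 2 ^ C by nia.
have AB : 36 * 2 ^ C <= 2 ^ a by nia.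
have cu : coprime u (2 ^ C) by rewrite coprimeXr // coprimen2.
have [i i' ei hi'] := egcdnP (2 ^ C) u0; rewrite (eqP cu) muln1 in ei hi'.
have hi : i <= 2 ^ C by nia.
(* The term [u * 3] keeps the subtraction of [w <= 3] exact. *)
have [j hj htj] := tm0_odd_progression (u * 3 + i' - w) (tm0 u) ou hw.
have ej : u * j + (u * 3 + i' - w) + w = u * (j + 3) + i' by nia.
set q := u * (j + 3) + i' in ej.
set r := 2 ^ C * (j + 3) + i.
have hr : r <= 11 * 2 ^ C by rewrite /r; nia.
have hq : q < 12 * 2 ^ C by rewrite /q; nia.
have erm : r * m + r * w = 2 ^ a * 2 ^ C * q + 2 ^ a.
  by rewrite -mulnDr hm /r /q mulnCA mulnDl ei; ring.
have rw : r * w <= 2 ^ a by clear -hw hr AB; case: hw => ->; lia.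
exists r; first by rewrite mulnC mulnCA leq_mul2l (leq_trans hr) ?orbT // leq_mul2r orbT.
rewrite -expnD; apply: (@same_block_one _ _ _ q); rewrite ?expnD.
- have -> : m + q = 2 ^ a * u + (u * j + (u * 3 + i' - w)) by rewrite -ej -hm; ring.
  rewrite tm0_split; last by lia.
  by rewrite -htj ej; move: (tm0 _) (tm0 _) => [] [].
- by lia.
- have : 2 ^ a * u.+1 <= 2 ^ a * 2 ^ C by rewrite leq_mul2l uB orbT.
  by rewrite !mulnS; lia.
Qed.

(* The coarse bound is used when 2^a is a small fraction of m; otherwise u and
   2^(e - a) are bounded in terms of N. *)
Lemma small_shift N : exists M, forall m e, odd m -> M <= m ->
  m + 4 <= 2 ^ e -> 2 ^ e <= 4 * m ->
  exists2 r, r * N <= m & same_block m r (r + 2 ^ e).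
Proof.
pose L := 13 * N.+1.
exists (150 * L * L) => m e om hM he1 he2.
have m5 : 5 <= m by nia.
have [a [u [w [ou ha hw hm]]]] := near_multiple_pow2 om m5.
have [hA|hA] := leqP (2 ^ a * L) m.
  have [|r hr hs] := small_shift_coarse ou ha hw hm _ he2; first by lia.
  exists r => //; rewrite /L in hA.
  by apply: leq_trans hA; rewrite mulnCA; nia.
have hL : 150 * L < 2 ^ a by nia.
(* Here [2 ^ e <= 4 * m < 4 * L * 2 ^ a], and 36 * 4 = 144 is below 150. *)
have h36 : 36 * 2 ^ e <= 2 ^ a * 2 ^ a.
  apply: (@leq_trans (144 * L * 2 ^ a)); first by lia.
  by rewrite leq_mul2r; lia.
have [r hr hs] : exists2 r, r * 2 ^ a <= 12 * 2 ^ e & same_block m r (r + 2 ^ e).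
  by case: hm => hm; [apply: small_shift_fine_pos h36|apply: small_shift_fine_neg h36];
    eauto.
have hrL : r <= 48 * L.
  have : r * 2 ^ a <= 48 * L * 2 ^ a by lia.
  by rewrite leq_mul2r; lia.
exists r => //; apply: leq_trans hM.
apply: (@leq_trans (48 * L * L)); last by rewrite !leq_mul2r orbT.
by apply: leq_mul => //; rewrite /L; lia.
Qed.

(** * Anti-powers as distinct blocks, and their existence *)

Definition block (m j : nat) : seq bool := [seq tm0 n | n <- iota (j * m) m].

Lemma eq_blockP m i j : block m i = block m j <-> same_block m i j.
Proof.
have E r : block m r = mkseq (fun n => tm0 (r * m + n)) m.
  by rewrite /block -{1}[r * m]addn0 iotaDl -map_comp.
rewrite !E; split=> [/(congr1 (nth false)) h n hn|h].
  by have := congr1 (@^~ n) h; rewrite /= !nth_mkseq.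
by apply/eq_in_map => n; rewrite mem_iota => /andP[_ hn]; apply: h.
Qed.

Lemma inF_blocks k m : 0 < k ->
  inF k m = odd m && uniq [seq block m j | j <- iota 0 k].
Proof.
move=> k0; rewrite /inF /anti_power.
have -> : tm_factor 1 (k * m) = [seq tm0 n | n <- iota 0 (k * m)].
  by rewrite /tm_factor subn1 (iotaDl 1 0) -map_comp.
rewrite size_map size_iota dvdn_mulr // mulKn //; congr (_ && uniq _).
apply/eq_in_map => j; rewrite mem_iota => /andP[_ hj].
rewrite -map_drop -map_take /block drop_iota take_iota add0n.
by congr (map _ (iota _ _)); apply/minn_idPl; rewrite -mulnBl leq_pmull // subn_gt0.
Qed.

Lemma inF_odd k m : inF k m -> odd m. Proof. by case/andP. Qed.

Lemma inF_same_block k m i j : inF k m -> i < j -> same_block m i j -> k <= j.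
Proof.
case: (posnP k) => [-> //|k0]; rewrite inF_blocks // => /andP[_ /(uniqP [::]) h] ij.
move=> /eq_blockP E; rewrite leqNgt; apply/negP => jk.
have := h i j; rewrite !inE size_map size_iota (ltn_trans ij jk) jk => /(_ isT isT).
rewrite !(nth_map 0) ?size_iota // ?(ltn_trans ij jk) // !nth_iota ?(ltn_trans ij jk) // !add0n.
by move=> /(_ E) e; rewrite e ltnn in ij.
Qed.

(** There are only [2 ^ m] words of length [m]. Hence large [k] forces large [m]. *)
Lemma inF_le_exp k m : inF k m -> k <= 2 ^ m.
Proof.
case: (posnP k) => [-> //|k0]; rewrite inF_blocks // => /andP[_ h].
have hs j : size (block m j) == m by rewrite size_map size_iota.
have e : [seq block m j | j <- iota 0 k] = [seq tval (Tuple (hs j)) | j <- iota 0 k] by [].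
rewrite e (map_comp val) map_inj_uniq in h; last exact: val_inj.
by have := card_uniqP h; rewrite size_map size_iota => <-; rewrite -card_bool -card_tuple max_card.
Qed.

(** Choose the offset n so that i + n is [2 ^ A * y] plus A low ones; then j + n carries into y + 1.
    Equality would make t(y) + t(y + 1) constant modulo 2 for y < 4, but y = 1 and y = 2
    disagree. *)
Lemma not_same_block_pow2S A i j : i < j -> j < 2 ^ A ->
  ~ same_block (2 ^ (A + 3)).+1 i j.
Proof.
move=> ij jA h.
have A0 : 0 < 2 ^ A by rewrite expn_gt0.
have e3 : 2 ^ (A + 3) = 2 ^ A * 8 by rewrite expnD.
have key y : y < 4 -> tm0 i (+) tm0 y (+) tm0 (2 ^ A).-1 =
    tm0 j (+) tm0 y.+1 (+) tm0 (j - i).-1.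
  move=> hy.
  have hn : 2 ^ A * y + (2 ^ A).-1 - i + j < 2 ^ (A + 3) by nia.
  have := h (2 ^ A * y + (2 ^ A).-1 - i).
  have -> : i * (2 ^ (A + 3)).+1 + (2 ^ A * y + (2 ^ A).-1 - i) =
    2 ^ (A + 3) * i + (2 ^ A * y + (2 ^ A).-1) by rewrite mulnS; lia.
  have -> : j * (2 ^ (A + 3)).+1 + (2 ^ A * y + (2 ^ A).-1 - i) =
    2 ^ (A + 3) * j + (2 ^ A * y.+1 + (j - i).-1) by rewrite !mulnS; lia.
  by rewrite !tm0_split ?addbA; try nia; apply; lia.
have := key 1 isT; have := key 2 isT.
rewrite (_ : tm0 1 = true) // (_ : tm0 2 = true) // (_ : tm0 3 = false) //.
by move: (tm0 i) (tm0 j) (tm0 _.-1) (tm0 _.-1) => [] [] [] [].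
Qed.

(* Without this, [gamma k] could be the junk value 0. *)
Lemma inF_nonempty k : exists m, inF k m.
Proof.
case: (posnP k) => [->|k0].
  by exists 1.
exists (2 ^ (k + 3)).+1; rewrite inF_blocks //; apply/andP; split.
  by rewrite /= oddX addn3.
rewrite map_inj_in_uniq ?iota_uniq // => i j; rewrite !mem_iota !add0n /= => hi hj /eq_blockP h.
have hk : k < 2 ^ k by apply: ltn_expl.
have [ij|ij|//] := ltngtP i j.
  by case: (not_same_block_pow2S ij (ltn_trans hj hk)).
by case: (not_same_block_pow2S ij (ltn_trans hi hk)) => n hn; rewrite h.
Qed.

Lemma gammaP k : inF k (gamma k).
Proof.
rewrite /gamma; case: excluded_middle_informative => [H|[]]; last exact: inF_nonempty.
by case: ex_minnP.
Qed.

(** * Lower bounds for gamma *)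

Lemma inF_lower N : 0 < N -> exists M, forall k m, M <= m -> inF k m ->
  k * N <= (2 * N + 1) * m.
Proof.
move=> N0; have [M hM] := small_shift (2 * N).
(* Of the excess m / N over 2m, half pays for [r] and half for the 6 in [2 ^ e <= 2 * m + 6]. *)
exists (M + 6 * (2 * N) + 5) => k m hm hk.
have [e he he2] : exists2 e, m + 4 <= 2 ^ e & 2 ^ e <= 2 * m + 6.
  exists (up_log 2 (m + 4)); first exact: up_logP.
  have : 2 ^ (up_log 2 (m + 4)).-1 < m + 4 by rewrite up_log_gtn //; lia.
  have : 0 < up_log 2 (m + 4) by rewrite up_log_gt0; lia.
  by case: (up_log _ _) => // e _ /=; rewrite expnS; lia.
have [|||r hr hs] := hM m e (inF_odd hk); try lia.
have := inF_same_block hk _ hs; rewrite -{1}[r]addn0 ltn_add2l expn_gt0 => /(_ isT).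
nia.
Qed.

Lemma gamma_ge N : 0 < N -> exists K, forall k, K <= k ->
  k * N <= (2 * N + 1) * gamma k.
Proof.
move=> N0; have [M hM] := inF_lower N0.
exists (2 ^ M).+1 => k hk; apply: hM (gammaP k).
rewrite leqNgt; apply/negP => hg.
have := leq_trans hk (inF_le_exp (gammaP k)).
by rewrite ltn_exp2l // ltnNge ltnW.
Qed.

(** Otherwise, with e = n + t, equal blocks give k = 2^e + 2^n <= r + 2^e, whereas r 2^t <= m < 2^e
    gives r < 2^n. *)
Lemma gamma_ge_pow2 t : exists n0, forall n, n0 <= n ->
  2 ^ (n + t) <= gamma (2 ^ n * (2 ^ t).+1) + 3.
Proof.
have [M hM] := small_shift (2 ^ t); have [K hK] := gamma_ge (isT : 0 < 1).
exists (K + M) => n hn; set k := 2 ^ n * _; set m := gamma k.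
have hk : inF k m := gammaP k.
have hnk : 2 ^ n < k by rewrite /k mulnS -addn1 leq_add2l muln_gt0 !expn_gt0.
have hek : 2 ^ (n + t) < k by rewrite /k mulnS -expnD -{1}[2 ^ _]add0n ltn_add2r expn_gt0.
have n2n : n < 2 ^ n by apply: ltn_expl.
have hMm : M <= m.
  rewrite leqNgt; apply/negP => mM.
  have := inF_le_exp hk; have : 2 ^ m <= 2 ^ n by rewrite leq_exp2l //; lia.
  by lia.
(* This crude bound supplies [2 ^ e <= 4 * m]. *)
have h3 : k <= 3 * m by rewrite -[k]muln1; apply: hK; lia.
rewrite leqNgt; apply/negP => he.
have [||r hr hs] := hM m (n + t) (inF_odd hk) hMm; [lia|lia|].
have := inF_same_block hk _ hs; rewrite -{1}[r]addn0 ltn_add2l expn_gt0 => /(_ isT).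
have : r < 2 ^ n by rewrite -(@ltn_pmul2r (2 ^ t)) ?expn_gt0 // -expnD; lia.
by rewrite /k mulnS -expnD; lia.
Qed.

(** * Passage to the ratios *)

Local Open Scope ring_scope.

Lemma ex_nat_inv_lt (eps : rat) : 0 < eps -> exists2 N : nat, (0 < N)%N & 1 <= eps * N%:R.
Proof.
move=> e0; exists (Num.bound eps^-1).+1 => //.
rewrite mulrC -ler_pdivrMr // div1r -natr1.
by have := archi_boundP (ltW (etrans (invr_gt0 eps) e0)); lra.
Qed.

(* liminf_{k->oo} gamma(k)/k >= 1/2  and  limsup_{k->oo} gamma(k)/k >= 1 *)
Theorem theorem3 :
  (forall eps : rat, 0 < eps ->
     exists K : nat, forall k : nat, (K <= k)%N -> 1 / 2%:R - eps <= gamma_ratio k)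
  /\
  (forall eps : rat, 0 < eps ->
     forall K : nat, exists2 k : nat, (K <= k)%N & 1 - eps <= gamma_ratio k).
Proof.
split=> eps e0; have [N N0 hN] := ex_nat_inv_lt e0.
  have [K hK] := gamma_ge N0; exists K.+1 => k hk.
  have k0 : 0 < k%:R :> rat by rewrite ltr0n; lia.
  have := hK k (ltnW hk); rewrite -(ler_nat rat) !natrM natrD natrM => h.
  rewrite /gamma_ratio ler_pdivlMr //.
  have N0' : 0 < N%:R :> rat by rewrite ltr0n.
  rewrite -(ler_pM2r (_ : 0 < 2 * N%:R + 1)); last by lra.
  by nra.
move=> K; have [n0 hn] := gamma_ge_pow2 N.
(* The loss k - gamma(k) <= 2^n + 3 is at most eps 2^n (N + 1) <= eps k, since 1 <= eps N and
   [3 * N <= n] gives 3 <= eps 2^n. *)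
have [n [hn0 Kn Nn]] : exists n, [/\ n0 <= n, K <= n & 3 * N <= n]%N.
  by exists (n0 + K + 3 * N)%N; split; lia.
pose k := (2 ^ n * (2 ^ N).+1)%N.
have n2n : (n < 2 ^ n)%N by apply: ltn_expl.
have N2N : (N < 2 ^ N)%N by apply: ltn_expl.
have hnk : (2 ^ n <= k)%N by rewrite leq_pmulr.
exists k; first exact: leq_trans Kn (leq_trans (ltnW n2n) hnk).
have k0 : 0 < k%:R :> rat by rewrite ltr0n (leq_trans _ hnk) ?expn_gt0.
have := hn n hn0; rewrite -/k => h.
rewrite /gamma_ratio ler_pdivlMr //.
have h1 : (2 ^ n)%:R * (2 ^ N)%:R <= (gamma k)%:R + 3 :> rat.
  by rewrite -natrM -natrD ler_nat -expnD.
have h2 : N%:R + 1 <= (2 ^ N)%:R :> rat by rewrite natr1 ler_nat.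
have h3 : 3 * N%:R <= (2 ^ n)%:R :> rat by rewrite -natrM ler_nat; lia.
have -> : k%:R = (2 ^ n)%:R * ((2 ^ N)%:R + 1) :> rat by rewrite natr1 -natrM.
have h4 : 3 <= eps * (2 ^ n)%:R.
  by have := ler_wpM2l (ltW e0) h3; lra.
have h5 : eps * (2 ^ n)%:R * (N%:R + 1) <= eps * (2 ^ n)%:R * (2 ^ N)%:R.
  by apply: ler_wpM2l h2; lra.
have h6 : (2 ^ n)%:R <= eps * N%:R * (2 ^ n)%:R by rewrite ler_peMl // ler0n.
by lra.
Qed.
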